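(* Let $n\ge1$ and let $\mathcal{F}\subseteq 2^{[n]}$ be a family of subsets of $[n]=\{1,\dots,n\}$ which is union-closed (i.e. $S\cup T\in\mathcal F$ whenever $S,T\in\mathcal F$) and which contains at least one nonempty set. Then there exists $i\in[n]$ such that $i$ belongs to at least a $\frac{3-\sqrt5}{2}$ fraction of the sets in $\mathcal F$, i.e. $|\{S\in\mathcal F: i\in S\}|\ge \frac{3-\sqrt5}{2}|\mathcal F|$. *)

(* Defs.v *)
From mathcomp Require Import all_boot all_order all_algebra.
From mathcomp Require Import reals.

Set Implicit Arguments.
Unset Strict Implicit.
Unset Printing Implicit Defensive.

Definition union_closed (T : finType) (F : {set {set T}}) : Prop :=
  forall A B : {set T}, A \in F -> B \in F -> A :|: B \in F.

(* Main.v *)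
(* The entropy method of Gilmer.  Let [phi = (sqrt 5 - 1) / 2], let [h] be the
   binary entropy, and draw two sets [A], [B] independently and uniformly from a
   union-closed family [F].  Revealing coordinates one at a time, the entropy of
   [A :|: B] is at least the sum of the means of [h (x_i y_i)], where [x_i] and
   [y_i] are the conditional probabilities that [i] is missing from [A] and [B].
   The inequality [x h(y) + y h(x) <= 2 phi h(x y)] bounds this sum below by
   [phi^-1] times the sum of [Pr (i \notin A) * H (A_i | A_0, ..., A_(i-1))].  If
   every [i] were missing with probability more than [phi], this would exceed
   the entropy [ln #|F|] of [A], the maximum possible for a variable with values
   in [F].  The recursion on coordinates is carried out for two families and
   with the logarithm of the number of unions instead of their entropy.

   On the diagonal the inequality is [h (x^2) >= (1 + phi) x h(x)], with
   equality at [0], [phi] and [1] (Boppana); it follows from counting sign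
   changes, since up to a positive factor the third derivative of the
   difference is a cubic that is concave on the positive axis. *)
From mathcomp Require Import all_classical all_reals all_analysis.
Require Import Defs.
From mathcomp Require Import all_boot all_order all_algebra.
From mathcomp Require Import reals.
From mathcomp Require Import ring lra.

Set Implicit Arguments.
Unset Strict Implicit.
Unset Printing Implicit Defensive.

Import Order.TTheory GRing.Theory Num.Theory.
Import numFieldNormedType.Exports.
Local Open Scope ring_scope.

(** * The mean value theorem on the open unit interval, as sign information on derivatives *)

Section MeanValue.
Variable R : realType.
Implicit Types (f df : R -> R) (a b : R).

Lemma mean_value_in01 f df a b :
  (forall x : R, 0 < x < 1 -> is_derive x 1 f (df x)) -> 0 < a -> a < b -> b < 1 ->
  exists2 c, a < c < b & f b - f a = df c * (b - a).
Proof.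
move=> fdf a0 ab b1.
have dfab x : a <= x <= b -> is_derive x 1 f (df x).
  by move=> /andP[ax xb]; apply: fdf; rewrite (lt_le_trans a0)//= (le_lt_trans xb).
have [|| c] := @MVT R f df a b ab.
- by move=> x /[!in_itv]/= /andP[ax xb]; apply: dfab; rewrite !ltW.
- apply: derivable_within_continuous => x /[!in_itv]/= xab.
  by have [] := dfab x xab.
- by rewrite in_itv/= => ? ?; exists c.
Qed.

Lemma derive_lt0_exists f df a b :
  (forall x : R, 0 < x < 1 -> is_derive x 1 f (df x)) -> 0 < a -> a < b -> b < 1 ->
  f b < f a -> exists2 c, a < c < b & df c < 0.
Proof.
move=> fdf a0 ab b1 fba; have [c cab E] := mean_value_in01 fdf a0 ab b1.
by exists c => //; rewrite -(pmulr_llt0 _ (x := b - a)) ?subr_gt0// -E subr_lt0.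
Qed.

Lemma derive_gt0_exists f df a b :
  (forall x : R, 0 < x < 1 -> is_derive x 1 f (df x)) -> 0 < a -> a < b -> b < 1 ->
  f a < f b -> exists2 c, a < c < b & 0 < df c.
Proof.
move=> fdf a0 ab b1 fba; have [c cab E] := mean_value_in01 fdf a0 ab b1.
by exists c => //; rewrite -(pmulr_lgt0 _ (x := b - a)) ?subr_gt0// -E subr_gt0.
Qed.

End MeanValue.

(** * Binary entropy in natural logarithms and its tangent bound *)

Section Entropy.
Variable R : realType.
Implicit Types x y : R.

Definition entropy (x : R) : R := - (x * ln x) - (1 - x) * ln (1 - x).

Lemma entropy0 : entropy 0 = 0.
Proof. by rewrite /entropy subr0 ln1 mul0r mulr0 !oppr0 addr0. Qed.

Lemma entropy1 : entropy 1 = 0.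
Proof. by rewrite /entropy subrr ln1 mul0r mulr0 !oppr0 addr0. Qed.

Lemma entropy_ge0 x : 0 <= x <= 1 -> 0 <= entropy x.
Proof.
move=> /andP[x0 x1]; rewrite /entropy addr_ge0// -mulrN mulr_ge0 ?subr_ge0//.
- by rewrite oppr_ge0 ln_le0.
- by rewrite oppr_ge0 ln_le0// gerBl.
Qed.

Lemma is_derive_ln1B x : x < 1 ->
  is_derive x 1 (fun t => ln (1 - t)) (- (1 - x)^-1).
Proof.
move=> x1; have h : 0 < 1 - x by rewrite subr_gt0.
have d : is_derive x 1 (fun t : R => 1 - t) (-1) by apply: is_derive_eq; ring.
have dl := is_derive1_ln h.
by have := @is_derive1_comp _ (@ln R) (fun t => 1 - t) x _ _ dl d; rewrite mulrN1.
Qed.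

Lemma is_derive_ln1D x : -1 < x ->
  is_derive x 1 (fun t => ln (1 + t)) (1 + x)^-1.
Proof.
move=> x1; have h : 0 < 1 + x by rewrite -ltrBlDl sub0r.
have d : is_derive x 1 (fun t : R => 1 + t) 1 by apply: is_derive_eq; ring.
have dl := is_derive1_ln h.
by have := @is_derive1_comp _ (@ln R) (fun t => 1 + t) x _ _ dl d; rewrite mulr1.
Qed.

Lemma is_derive_inv x : x != 0 -> is_derive x 1 (fun t => t^-1) (- x ^- 2).
Proof.
move=> x0; have := @is_deriveV R id x 1 1 x0 _.
by rewrite /GRing.scale/= mulr1; apply.
Qed.

Lemma ln_leB1 x : 0 < x -> ln x <= x - 1.
Proof.
move=> x0; rewrite -{1}(subrK 1 x) addrC.
by apply: le_ln1Dx; rewrite ltrBrDl subrr.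
Qed.

Lemma ln_ge1BV x : 0 < x -> 1 - x^-1 <= ln x.
Proof.
move=> x0; have := @ln_leB1 x^-1; rewrite invr_gt0 lnV// => /(_ x0).
by rewrite -lerN2 opprB opprK.
Qed.

Lemma derive_ln1B_div x : 0 < x < 1 ->
  is_derive x 1 (fun t => ln (1 - t) / t)
    (- (x^-1 / (1 - x) + x ^- 2 * ln (1 - x))).
Proof.
move=> /andP[x0 x1].
have d2 := is_derive_ln1B x1.
have d3 := is_derive_inv (lt0r_neq0 x0).
by apply: is_derive_eq; rewrite /GRing.scale/=; field; lra.
Qed.

(** This monotone slope gives the concavity behind [entropy_tangent]. The sign of its derivative
    comes from [ln u >= 1 - u^-1] at [u = 1 - z]. *)
Lemma ln1B_div_decreasing x y : 0 < x -> x <= y -> y < 1 ->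
  ln (1 - y) / y <= ln (1 - x) / x.
Proof.
move=> x0; rewrite le_eqVlt => /predU1P[-> //|xy] y1; rewrite leNgt.
apply/negP => /(derive_gt0_exists derive_ln1B_div x0 xy y1)[z /andP[xz zy]].
have z0 : 0 < z by lra.
have z1 : 0 < 1 - z by lra.
apply/negP; rewrite -leNgt oppr_le0.
have -> : z^-1 / (1 - z) + z ^- 2 * ln (1 - z) =
  z ^- 2 * (ln (1 - z) - (1 - (1 - z)^-1)) by field; lra.
by rewrite mulr_ge0 ?invr_ge0 ?exprn_ge0 ?subr_ge0 ?ln_ge1BV// ltW.
Qed.

(** For positive [t] the function is [entropy t / t - m * ln t]; here [m] is a slope, so the
    derivative changes sign only where [ln (1 - x) / x] crosses it. *)
Lemma derive_entropy_ratio m x : 0 < x < 1 ->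
  is_derive x 1 (fun t => - ln t - (t^-1 - 1) * ln (1 - t) - m * ln t)
    (x^-1 * (ln (1 - x) / x - m)).
Proof.
move=> /andP[x0 x1].
have d1 := is_derive1_ln x0.
have d2 := is_derive_ln1B x1.
have d3 := is_derive_inv (lt0r_neq0 x0).
by apply: is_derive_eq; rewrite /GRing.scale/=; field; lra.
Qed.

(* In the variable [ln x] the function [entropy x / x] is concave, and
   [ln (1 - m) / m] is its slope at [m]. *)
Lemma entropy_tangent m x : 0 < m < 1 -> 0 < x < 1 ->
  entropy x / x <= entropy m / m + ln (1 - m) / m * (ln x - ln m).
Proof.
move=> /andP[m0 m1] /andP[x0 x1].
have entropyE (z : R) : 0 < z ->
    entropy z / z = - ln z - (z^-1 - 1) * ln (1 - z).
  by move=> z0; rewrite /entropy; field; lra.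
rewrite !entropyE//; set k := ln (1 - m) / m.
suff : - ln x - (x^-1 - 1) * ln (1 - x) - k * ln x <=
       - ln m - (m^-1 - 1) * ln (1 - m) - k * ln m by lra.
rewrite leNgt; apply/negP.
have d := derive_entropy_ratio k.
case: (ltgtP x m) => [xm|mx|->]; last by rewrite ltxx.
- move=> /(derive_lt0_exists d x0 xm m1)[z /andP[xz zm]].
  have z0 := lt_trans x0 xz.
  rewrite pmulr_rlt0 ?invr_gt0// subr_lt0.
  by apply/negP; rewrite -leNgt ln1B_div_decreasing ?ltW.
- move=> /(derive_gt0_exists d m0 mx x1)[z /andP[mz zx]].
  have z0 := lt_trans m0 mz.
  rewrite pmulr_rgt0 ?invr_gt0// subr_gt0.
  by apply/negP; rewrite -leNgt ln1B_div_decreasing ?ltW// (lt_trans zx).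
Qed.

End Entropy.

(** * The golden ratio, the diagonal inequality and its extension to two variables *)

Section Diagonal.
Variable R : realType.
Implicit Types x a b d t : R.

Definition golden : R := (Num.sqrt 5 - 1) / 2.
Notation phi := golden.
Notation c := (1 + phi).

Lemma golden_sqr : phi ^+ 2 = 1 - phi.
Proof.
have s5 : Num.sqrt (5 : R) ^+ 2 = 5 by rewrite sqr_sqrtr.
by rewrite /golden; field: s5.
Qed.

Lemma golden_bounds : 3 / 5 < phi < 5 / 8.
Proof.
have phi_gt0 : 0 < phi.
  by rewrite /golden divr_gt0// subr_gt0 -{1}sqrtr1 ltr_sqrt// ltr1n.
have phi_sqr' : phi * phi + phi = 1 by rewrite -expr2 golden_sqr subrK.
by apply/andP; split; rewrite ltNge; apply/negP => h;
  have := ler_wpM2r (ltW phi_gt0) h; lra.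
Qed.

Lemma golden_gt0 : 0 < phi.
Proof. by have /andP[] := golden_bounds; lra. Qed.

(** The difference in the diagonal inequality, see [gapE], with the three logarithms separated for
    repeated differentiation. [gap1] and [gap2] are its derivatives, and [cubic] is the numerator of
    the third. *)
Definition gap (x : R) : R := (c - 2) * x ^+ 2 * ln x
  + (c * x * (1 - x) - (1 - x ^+ 2)) * ln (1 - x)
  - (1 - x ^+ 2) * ln (1 + x).
Definition gap1 (x : R) : R := (2 * c - 4) * x * ln x
  + (c + (2 - 2 * c) * x) * ln (1 - x) + 2 * x * ln (1 + x).
Definition gap2 (x : R) : R := (2 * c - 4) * (ln x + 1) + (2 - 2 * c) * ln (1 - x)
  - (c + (2 - 2 * c) * x) / (1 - x) + 2 * ln (1 + x) + 2 * x / (1 + x).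
Definition cubic (x : R) : R := - c * x ^+ 3 - 4 * x ^+ 2 + 3 * c * x + 2 * c - 4.

Lemma gapE x : 0 < x < 1 -> gap x = entropy (x ^+ 2) - c * x * entropy x.
Proof.
move=> /andP[x0 x1]; rewrite /gap /entropy.
have -> : 1 - x ^+ 2 = (1 - x) * (1 + x) by ring.
by rewrite expr2 !lnM ?posrE; [ring|lra..].
Qed.

Lemma derive_gap x : 0 < x < 1 -> is_derive x 1 gap (gap1 x).
Proof.
move=> /andP[x0 x1].
have d1 := is_derive1_ln x0.
have d2 := is_derive_ln1B x1.
have d3 : is_derive x 1 (fun t : R => ln (1 + t)) (1 + x)^-1.
  by apply: is_derive_ln1D; lra.
rewrite /gap; apply: is_derive_eq; rewrite /GRing.scale/= /gap1.
by field; lra.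
Qed.

Lemma derive_gap1 x : 0 < x < 1 -> is_derive x 1 gap1 (gap2 x).
Proof.
move=> /andP[x0 x1].
have d1 := is_derive1_ln x0.
have d2 := is_derive_ln1B x1.
have d3 : is_derive x 1 (fun t : R => ln (1 + t)) (1 + x)^-1.
  by apply: is_derive_ln1D; lra.
rewrite /gap1; apply: is_derive_eq; rewrite /GRing.scale/= /gap2.
by field; lra.
Qed.

Lemma derive_gap2 x : 0 < x < 1 ->
  is_derive x 1 gap2 (cubic x / (x * (1 - x ^+ 2) ^+ 2)).
Proof.
move=> /andP[x0 x1].
have d1 := is_derive1_ln x0.
have d2 := is_derive_ln1B x1.
have d3 : is_derive x 1 (fun t : R => ln (1 + t)) (1 + x)^-1.
  by apply: is_derive_ln1D; lra.
have d4 : is_derive x 1 (fun t : R => (1 - t)^-1) ((1 - x) ^- 2).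
  apply: is_derive_eq.
    by apply: is_deriveV; rewrite gt_eqF ?subr_gt0.
  by rewrite /GRing.scale/=; field; lra.
have d5 : is_derive x 1 (fun t : R => (1 + t)^-1) (- (1 + x) ^- 2).
  apply: is_derive_eq.
    by apply: is_deriveV; rewrite gt_eqF//; lra.
  by rewrite /GRing.scale/=; field; lra.
rewrite /gap2; apply: is_derive_eq; rewrite /GRing.scale/= /cubic.
have x1' : 1 + x != 0 by lra.
have x1'' : 1 - x ^+ 2 != 0.
  have -> : 1 - x ^+ 2 = (1 - x) * (1 + x) by ring.
  by rewrite mulf_neq0//; lra.
by field; repeat split; lra.
Qed.

Lemma cubic_concave a b d : 0 < a -> a < b -> b < d ->
  0 < cubic a -> cubic b < 0 -> cubic d <= 0.
Proof.
move=> a0 ab bd ca cb; rewrite leNgt; apply/negP => cd.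
have c0 : 0 < c by have := golden_gt0; lra.
(* Chord interpolation at [b]; the last factor is minus the second divided difference of [cubic],
   positive on the positive axis. *)
have E : cubic b * (d - a) = cubic a * (d - b) + cubic d * (b - a) +
    (d - a) * (d - b) * (b - a) * (c * (a + b + d) + 4).
  by rewrite /cubic; ring.
have : cubic b * (d - a) < 0 by rewrite pmulr_llt0//; lra.
rewrite E; apply/negP; rewrite -leNgt.
have q0 : 0 < c * (a + b + d) + 4.
  by apply: ltr_wpDl => //; apply: mulr_ge0; lra.
have r0 : 0 < (d - a) * (d - b) * (b - a) by rewrite !mulr_gt0 ?subr_gt0//; lra.
rewrite addr_ge0 ?addr_ge0 ?mulr_ge0 ?ltW//; lra.
Qed.

Lemma cubic_phi_gt0 : 0 < cubic phi.
Proof.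
have -> : cubic phi = 7 * phi - 4.
  by rewrite /cubic; ring: golden_sqr.
by have /andP[] := golden_bounds; lra.
Qed.

(** Since [1 - phi = phi ^+ 2] and [1 + phi = phi^-1], every logarithm at [phi] is a multiple of
    [ln phi], and the values of [gap] and [gap1] there become polynomial identities. *)
Lemma ln1Bphi : ln (1 - phi) = 2 * ln phi.
Proof. by rewrite -golden_sqr lnXn ?golden_gt0// mulr_natl. Qed.

Lemma ln1Dphi : ln (1 + phi) = - ln phi.
Proof.
rewrite -lnV ?posrE ?golden_gt0//; congr ln.
by apply: (mulIf (lt0r_neq0 golden_gt0)); rewrite mulVf ?gt_eqF ?golden_gt0//; ring: golden_sqr.
Qed.

Lemma gap_phi : gap phi = 0.
Proof. by rewrite /gap ln1Bphi ln1Dphi; ring: golden_sqr. Qed.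

Lemma gap1_phi : gap1 phi = 0.
Proof. by rewrite /gap1 ln1Bphi ln1Dphi; ring: golden_sqr. Qed.

(** The constant suits [gap2_phi_gt0]: [2 * c - 1 < (2 * c + 2) * (3 / 7)] is equivalent to
    [phi < 5 / 8]. The bound follows from [5 / 8 <= (6 / 7) ^+ 3] and
    [6 / 7 <= expR (- (1 / 7))]. *)
Lemma ln_phi_lt : ln phi < - (3 / 7).
Proof.
have /andP[_ phi_lt] := golden_bounds.
rewrite -ltr_expR lnK ?posrE ?golden_gt0//; apply: (lt_le_trans phi_lt).
have -> : - (3 / 7) = 3%:R * (- (1 / 7)) :> R by field.
rewrite expRM_natl; apply: (@le_trans _ _ ((1 - 1 / 7) ^+ 3)); first by lra.
rewrite lerXn2r ?nnegrE ?expR_ge0 ?expR_ge1Dx// subr_ge0.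
by rewrite ler_pdivrMr// mul1r ler1n.
Qed.

Lemma gap2_phi_gt0 : 0 < gap2 phi.
Proof.
have [/andP[phi_gt phi_lt] ln_lt] := (golden_bounds, ln_phi_lt).
rewrite /gap2 ln1Bphi ln1Dphi.
have V1B : (1 - phi)^-1 = 2 + phi.
  apply: (@mulIf _ (1 - phi)); first by lra.
  by rewrite mulVf; [ring: golden_sqr|lra].
have V1D : (1 + phi)^-1 = phi.
  apply: (@mulIf _ (1 + phi)); first by lra.
  by rewrite mulVf; [ring: golden_sqr|lra].
rewrite V1B V1D.
have -> : (2 * c - 4) * (ln phi + 1) + (2 - 2 * c) * (2 * ln phi)
    - (c + (2 - 2 * c) * phi) * (2 + phi) + 2 * - ln phi + 2 * phi * phi
  = (2 * c + 2) * (- ln phi) - (2 * c - 1).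
  by ring: golden_sqr.
have : (2 * c + 2) * (3 / 7) < (2 * c + 2) * (- ln phi).
  by rewrite ltr_pM2l; lra.
by lra.
Qed.

(** An explicit bound replaces the limit of [gap] at [0]; crude estimates [entropy x <= 1] and
    [c <= 2] suffice. *)
Lemma gap_ge_near0 x : 0 < x < 1 -> - (2 * x) <= gap x.
Proof.
move=> x01; have /andP[x0 x1] := x01; rewrite gapE//.
have /andP[phi_gt phi_lt] := golden_bounds.
have h1 : entropy x <= 1.
  have hx := ln_ge1BV x0.
  have hx' : 1 - (1 - x)^-1 <= ln (1 - x) by apply: ln_ge1BV; lra.
  have : x * (1 - x^-1) <= x * ln x by rewrite ler_pM2l.
  have : (1 - x) * (1 - (1 - x)^-1) <= (1 - x) * ln (1 - x).
    by rewrite ler_pM2l//; lra.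
  by rewrite /entropy !mulrBr !mulr1 !mulfV; lra.
have h0 : 0 <= entropy (x ^+ 2).
  by apply: entropy_ge0; rewrite sqr_ge0 expr_le1 ?ltW.
have : c * x * entropy x <= c * x * 1.
  by rewrite ler_pM2l// mulr_gt0//; lra.
have : c * x <= 2 * x by rewrite ler_pM2r//; lra.
lra.
Qed.

(** The square in [1 - t ^+ 2] absorbs the logarithmic singularity: [ln t >= 1 - t^-1] makes
    [t ^+ 2 * ln t] at least [t ^+ 2 - t], so the bound is linear in [t]. *)
Lemma gap_ge_near1 t : 0 < t < 1 -> - (4 * t) <= gap (1 - t ^+ 2).
Proof.
move=> /andP[t0 t1].
have /andP[phi_gt phi_lt] := golden_bounds.
have t20 : 0 < t ^+ 2 by rewrite exprn_gt0.
have t21 : t ^+ 2 < 1 by rewrite expr_lt1 ?ltW.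
rewrite gapE; last by lra.
set x := 1 - t ^+ 2.
have x0 : 0 < x by rewrite /x; lra.
have x1 : x < 1 by rewrite /x; lra.
have ht : entropy x <= 2 * t.
  rewrite /entropy /x (_ : 1 - (1 - t ^+ 2) = t ^+ 2); last by ring.
  rewrite lnXn//.
  have : x * (1 - x^-1) <= x * ln x by rewrite ler_pM2l// ln_ge1BV.
  have : t ^+ 2 * (1 - t^-1) <= t ^+ 2 * ln t by rewrite ler_pM2l// ln_ge1BV.
  rewrite (_ : x * (1 - x^-1) = x - 1); last by field; rewrite gt_eqF.
  rewrite (_ : t ^+ 2 * (1 - t^-1) = t ^+ 2 - t); last by field; rewrite gt_eqF.
  by rewrite /x; lra.
have h0 : 0 <= entropy (x ^+ 2).
  by apply: entropy_ge0; rewrite sqr_ge0 expr_le1 ?ltW.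
have e0 : 0 <= entropy x by apply: entropy_ge0; rewrite !ltW.
have : c * x * entropy x <= 2 * entropy x.
  rewrite ler_wpM2r// (@le_trans _ _ (c * 1))//; last by lra.
  by rewrite ler_pM2l//; lra.
lra.
Qed.

Lemma gap1_ge_near0 x : 0 < x < 1 / 2 -> - (4 * x) <= gap1 x.
Proof.
move=> /andP[x0 x1]; have /andP[phi_gt phi_lt] := golden_bounds.
have c0 : 0 < c by have := golden_gt0; lra.
have h1 : 0 <= (2 * c - 4) * x * ln x.
  by rewrite mulr_le0 ?ln_le0//; [rewrite nmulr_rle0//|]; lra.
have h2 : 0 <= 2 * x * ln (1 + x) by rewrite mulr_ge0 ?ln_ge0//; lra.
have h3 : c * ln (1 - x) <= (c + (2 - 2 * c) * x) * ln (1 - x).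
  rewrite ler_wnM2r ?ln_le0//; first lra.
  by rewrite gerDl nmulr_rle0 ?ltW//; lra.
have h4 : - (2 * x) <= ln (1 - x).
  apply: (@le_trans _ _ (1 - (1 - x)^-1)); last by apply: ln_ge1BV; lra.
  have : 0 <= x * (1 - 2 * x) by rewrite mulr_ge0//; lra.
  have : (1 - x)^-1 <= 1 + 2 * x -> - (2 * x) <= 1 - (1 - x)^-1 by lra.
  by move=> + ?; apply; rewrite -div1r ler_pdivrMr; lra.
have h5 : c * - (2 * x) <= c * ln (1 - x) by rewrite ler_pM2l.
have : c * (2 * x) <= 2 * (2 * x) by rewrite ler_pM2r; lra.
by rewrite /gap1; lra.
Qed.

Lemma lt_pair_exists a b : 0 < a -> 0 < b -> exists t, [/\ 0 < t, t < a & t < b].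
Proof.
by move=> a0 b0; exists (Num.min a b / 2); case: (leP a b) => ab; split; lra.
Qed.

Lemma denominator_gt0 x : 0 < x < 1 -> 0 < (x * (1 - x ^+ 2) ^+ 2)^-1.
Proof.
move=> /andP[x0 x1]; rewrite invr_gt0 mulr_gt0// exprn_gt0// subr_gt0.
by rewrite expr_lt1// ltW.
Qed.

Lemma gap2_decrease_cubic a b : 0 < a -> a < b -> b < 1 -> gap2 b < gap2 a ->
  exists2 p, a < p < b & cubic p < 0.
Proof.
move=> a0 ab b1 /(derive_lt0_exists derive_gap2 a0 ab b1)[p /andP[ap pb]].
rewrite pmulr_llt0 => [cp|]; first by exists p; rewrite ?ap.
by apply: denominator_gt0; rewrite (lt_trans a0 ap) (lt_trans pb b1).
Qed.

Lemma gap2_increase_cubic a b : 0 < a -> a < b -> b < 1 -> gap2 a < gap2 b ->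
  exists2 p, a < p < b & 0 < cubic p.
Proof.
move=> a0 ab b1 /(derive_gt0_exists derive_gap2 a0 ab b1)[p /andP[ap pb]].
rewrite pmulr_lgt0 => [cp|]; first by exists p; rewrite ?ap.
by apply: denominator_gt0; rewrite (lt_trans a0 ap) (lt_trans pb b1).
Qed.

(* If [gap x < 0] the derivatives alternate in sign so often that, by Rolle,
   [cubic] takes a negative value between two positive ones. *)
Lemma gap_ge0_right x : phi < x < 1 -> 0 <= gap x.
Proof.
move=> /andP[phix x1]; rewrite leNgt; apply/negP => gx.
have phi0 := golden_gt0.
have x0 := lt_trans phi0 phix.
(* This [t] puts [1 - t ^+ 2] to the right of [x], with a value of [gap] above [gap x]. *)
have [||t [t0 t1 tg]] := @lt_pair_exists (1 - x) (- gap x / 4).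
- by lra.
- by lra.
have tt : t ^+ 2 < t by rewrite expr2 gtr_pMr//; lra.
have t20 : 0 < t ^+ 2 by rewrite exprn_gt0.
have gt : gap x < gap (1 - t ^+ 2).
  by apply: lt_le_trans (gap_ge_near1 _); [lra | rewrite t0; lra].
have [|z1 /andP[az1 z1b] g1] := derive_lt0_exists derive_gap phi0 phix x1.
  by rewrite gap_phi.
have z10 := lt_trans phi0 az1.
have [|z2 /andP[az2 z2b] g2] :=
  derive_lt0_exists derive_gap1 phi0 az1 (lt_trans z1b x1).
  by rewrite gap1_phi.
have z20 := lt_trans phi0 az2.
have z21 := lt_trans z2b (lt_trans z1b x1).
have xt : x < 1 - t ^+ 2 by clear -tt t1; lra.
have t21 : 1 - t ^+ 2 < 1 by rewrite gtrBl.
have [z3 /andP[az3 z3b] g3] := derive_gt0_exists derive_gap x0 xt t21 gt.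
have z31 := lt_trans z3b t21.
have z13 := lt_trans z1b az3.
have [z4 /andP[az4 z4b] g4] :=
  derive_gt0_exists derive_gap1 z10 z13 z31 (lt_trans g1 g3).
have z41 := lt_trans z4b z31.
have z24 := lt_trans z2b az4.
(* The order is [phi < p1 < z2 < p2], with [cubic] positive, negative, positive at [phi], [p1],
   [p2]. *)
have [p1 /andP[ap1 p1b] k1] :=
  gap2_decrease_cubic phi0 az2 z21 (lt_trans g2 gap2_phi_gt0).
have [p2 /andP[ap2 p2b]] := gap2_increase_cubic z20 z24 z41 (lt_trans g2 g4).
apply/negP; rewrite -leNgt.
exact: cubic_concave phi0 ap1 (lt_trans p1b ap2) cubic_phi_gt0 k1.
Qed.

(** The mirrored argument: a negative [gap x] gives [p1 < p2 < phi] with [cubic] positive at [p1]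
    and negative at [p2], contradicting [cubic_phi_gt0]. Points [d] and [e] near [0] supply the
    extra sign changes of [gap1] and [gap2]. *)
Lemma gap_ge0_left x : 0 < x < phi -> 0 <= gap x.
Proof.
move=> /andP[x0 xphi]; rewrite leNgt; apply/negP => gx.
have /andP[_ phi58] := golden_bounds.
have phi0 := golden_gt0.
have phi1 : phi < 1 by lra.
have [||d [d0 dx dg]] := @lt_pair_exists x (- gap x / 2) => //.
  by lra.
have [|z1 /andP[xz1 z1p] g1] := derive_gt0_exists derive_gap x0 xphi phi1.
  by rewrite gap_phi.
have z10 := lt_trans x0 xz1.
have [|z2 /andP[z12 z2p] g2] := derive_lt0_exists derive_gap1 z10 z1p phi1.
  by rewrite gap1_phi.
have x1 := lt_trans xphi phi1.
have z11 := lt_trans z1p phi1.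
have z20 := lt_trans z10 z12.
have gd : gap x < gap d.
  apply: lt_le_trans (gap_ge_near0 _); last by rewrite d0 (lt_trans dx).
  by clear -dg; lra.
have [z3 /andP[dz3 z3x] g3] := derive_lt0_exists derive_gap d0 dx x1 gd.
have z30 := lt_trans d0 dz3.
have z31 := lt_trans z3x xz1.
have [z4 /andP[z34 z41] g4] :=
  derive_gt0_exists derive_gap1 z30 z31 z11 (lt_trans g3 g1).
have [||e0' [e'0 e'z e'g]] := @lt_pair_exists z3 (- gap1 z3 / 4) => //.
  by clear -g3; lra.
have [||e [e0 ee' ee]] := @lt_pair_exists e0' (1 / 2) => //.
have ez := lt_trans ee' e'z.
have eg := lt_trans ee' e'g.
have ge' : gap1 z3 < gap1 e.
  apply: lt_le_trans (gap1_ge_near0 _); last by rewrite e0.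
  by clear -eg; lra.
have [z5 /andP[z5e z53] g5] :=
  derive_lt0_exists derive_gap1 e0 ez (lt_trans z31 z11) ge'.
have z50 := lt_trans e0 z5e.
have z54 := lt_trans z53 z34.
have z42 := lt_trans z41 z12.
have z21 := lt_trans z2p phi1.
have [p1 /andP[ap1 p1b] k1] :=
  gap2_increase_cubic z50 z54 (lt_trans z41 z11) (lt_trans g5 g4).
have [p2 /andP[ap2 p2b] k2] :=
  gap2_decrease_cubic (lt_trans z50 z54) z42 z21 (lt_trans g2 g4).
have p10 := lt_trans z50 ap1.
have := cubic_concave p10 (lt_trans p1b ap2) (lt_trans p2b z2p) k1 k2.
by apply/negP; rewrite -ltNge; exact: cubic_phi_gt0.
Qed.

Lemma entropy_sqr x : 0 < x < 1 -> c * x * entropy x <= entropy (x ^+ 2).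
Proof.
move=> x01; have /andP[x0 x1] := x01.
rewrite -subr_ge0 -gapE//; case: (ltgtP x phi) => [xp|px|->].
- by apply: gap_ge0_left; rewrite x0.
- by apply: gap_ge0_right; rewrite px.
- by rewrite gap_phi.
Qed.

(* Concavity of [entropy x / x] in [ln x] reduces to the case [x = y]. *)
Lemma entropy_mul x y : 0 <= x <= 1 -> 0 <= y <= 1 ->
  x * entropy y + y * entropy x <= 2 * phi * entropy (x * y).
Proof.
move=> /andP[x0 x1] /andP[y0 y1].
have /andP[phi35 phi58] := golden_bounds.
(* When [x] or [y] is [1] only [1 <= 2 * phi] is needed. *)
have weaken z : 0 <= z <= 1 -> entropy z <= 2 * phi * entropy z.
  by move=> /entropy_ge0 z0; rewrite ler_peMl//; lra.
move: x0 x1 y0 y1; rewrite le_eqVlt => /predU1P[<-|x0].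
  by rewrite !mul0r entropy0 !mulr0 addr0.
rewrite le_eqVlt => /predU1P[->|x1].
  move=> y0 y1; rewrite !mul1r entropy1 mulr0 addr0.
  by apply: weaken; rewrite y0.
rewrite le_eqVlt => /predU1P[<-|y0].
  by rewrite !mul0r !mulr0 !entropy0 !mulr0 addr0.
rewrite le_eqVlt => /predU1P[->|y1].
  by rewrite entropy1 mulr0 add0r mulr1 mul1r weaken// !ltW.
have xy0 : 0 < x * y by rewrite mulr_gt0.
have xy1 : x * y < 1 by rewrite mulr_ilt1// ltW.
(* At the geometric mean the slope terms of the two tangent bounds cancel, as
   [ln x + ln y = 2 * ln m]. *)
set m := Num.sqrt (x * y).
have m2 : m ^+ 2 = x * y by rewrite sqr_sqrtr// ltW.
have m0 : 0 < m by rewrite sqrtr_gt0.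
have m1 : m < 1 by rewrite -(expr_lt1 (n := 2))// ?m2// ltW.
have m01 : 0 < m < 1 by rewrite m0.
have tx : entropy x / x <= entropy m / m + ln (1 - m) / m * (ln x - ln m).
  by apply: entropy_tangent; rewrite ?x0.
have ty : entropy y / y <= entropy m / m + ln (1 - m) / m * (ln y - ln m).
  by apply: entropy_tangent; rewrite ?y0.
have lnm : ln x + ln y = 2 * ln m.
  by rewrite -lnM ?posrE// -m2 lnXn// mulr_natl.
have sum_le : entropy x / x + entropy y / y <= 2 * (entropy m / m).
  apply: le_trans (lerD tx ty) _; rewrite le_eqVlt; apply/orP; left; apply/eqP.
  by rewrite (_ : ln y = 2 * ln m - ln x); [ring | rewrite -lnm; ring].
have -> : x * entropy y + y * entropy x =
    m ^+ 2 * (entropy x / x + entropy y / y).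
  by rewrite m2; field; rewrite !gt_eqF.
have phiV : phi * c = 1 by ring: golden_sqr.
apply: (@le_trans _ _ (m ^+ 2 * (2 * (entropy m / m)))).
  by rewrite ler_pM2l// exprn_gt0.
have -> : m ^+ 2 * (2 * (entropy m / m)) = 2 * phi * (c * m * entropy m).
  rewrite (_ : 2 * phi * (c * m * entropy m) = phi * c * (2 * m * entropy m)).
    by rewrite phiV; field; rewrite gt_eqF.
  by ring.
by rewrite -m2 ler_pM2l ?entropy_sqr// mulr_gt0// golden_gt0.
Qed.

End Diagonal.

(** * The chain rule and the Gibbs inequality for a two-way split *)

Section EntropyInequalities.
Variable R : realType.
Implicit Types a b p : R.

Lemma entropy_chain a b : 0 <= a -> 0 <= b ->
  (a + b) * ln (a + b) = (a + b) * entropy (a / (a + b)) + a * ln a + b * ln b.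
Proof.
rewrite le_eqVlt => /predU1P[<- _|a0].
  by rewrite !add0r !mul0r entropy0 mulr0 !add0r.
rewrite le_eqVlt => /predU1P[<-|b0].
  by rewrite !addr0 divff ?gt_eqF// entropy1 mul0r mulr0 addr0 add0r.
have ab0 : 0 < a + b by rewrite addr_gt0.
have -> : entropy (a / (a + b)) =
    - (a / (a + b) * ln (a / (a + b))) - b / (a + b) * ln (b / (a + b)).
  rewrite /entropy (_ : 1 - a / (a + b) = b / (a + b))//.
  by field; rewrite gt_eqF.
by rewrite !ln_div ?posrE//; field; rewrite gt_eqF.
Qed.

(** Nonnegativity of the relative entropy of [(p, 1 - p)] with respect to [(a, b) / (a + b)]. The
    two implications are absolute continuity, which the convention [ln 0 = 0] would otherwise
    hide. *)
Lemma gibbs p a b : 0 <= p <= 1 -> 0 <= a -> 0 <= b ->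
  (a = 0 -> p = 0) -> (b = 0 -> p = 1) ->
  entropy p + p * ln a + (1 - p) * ln b <= ln (a + b).
Proof.
move=> /andP[p0 p1] a0 b0 ap bp.
have [p_eq0|p_neq0] := eqVneq p 0.
  have b_gt0 : 0 < b.
    rewrite lt_def b0 andbT; apply/eqP => /bp/eqP.
    by rewrite p_eq0 eq_sym oner_eq0.
  rewrite p_eq0 entropy0 mul0r subr0 mul1r !add0r.
  by rewrite ler_ln ?posrE// ?ltr_wpDl// lerDr.
have [p_eq1|p_neq1] := eqVneq p 1.
  have a_gt0 : 0 < a.
    rewrite lt_def a0 andbT; apply/eqP => /ap/eqP.
    by rewrite (negPf p_neq0).
  rewrite p_eq1 entropy1 mul1r subrr mul0r addr0 add0r.
  by rewrite ler_ln ?posrE// ?ltr_wpDr// lerDl.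
have a_gt0 : 0 < a.
  by rewrite lt_def a0 andbT; apply: contra_neq p_neq0 => /ap.
have b_gt0 : 0 < b.
  by rewrite lt_def b0 andbT; apply: contra_neq p_neq1 => /bp.
have p_gt0 : 0 < p by rewrite lt_def p_neq0.
have q_gt0 : 0 < 1 - p by rewrite subr_gt0 lt_def eq_sym p_neq1.
have ab_gt0 : 0 < a + b by rewrite addr_gt0.
(* This is [ln u <= u - 1] at [u = x / q / (a + b)]; the right sides for [(a, p)] and [(b, 1 - p)]
   add up to [0]. *)
have bound x q : 0 < x -> 0 < q ->
    q * (ln x - ln q - ln (a + b)) <= x / (a + b) - q.
  move=> x0 q0; rewrite -!ln_div ?posrE ?divr_gt0//.
  have -> : x / (a + b) - q = q * (x / q / (a + b) - 1).
    by field; rewrite !gt_eqF.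
  by rewrite ler_pM2l// ln_leB1// !divr_gt0.
have := lerD (bound a p a_gt0 p_gt0) (bound b (1 - p) b_gt0 q_gt0).
rewrite (_ : a / (a + b) - p + (b / (a + b) - (1 - p)) = 0); last first.
  by field; rewrite gt_eqF.
by rewrite /entropy; lra.
Qed.

End EntropyInequalities.

(** * Families of bit sequences and their recursion on the first bit *)

Section BitFamilies.
Variable R : realType.
Implicit Types (n i : nat) (P Q C : bitseq -> bool) (s t : bitseq).

Fixpoint bitseqs n : seq bitseq :=
  if n is m.+1 then map (cons false) (bitseqs m) ++ map (cons true) (bitseqs m)
  else [:: [::]].

(** The members of [P] that begin with [b], with that bit removed: conditioning on the first
    coordinate. *)
Definition residual (b : bool) P : bitseq -> bool := fun s => P (b :: s).

Definition size_of n P := count P (bitseqs n).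

Definition size_without n P i :=
  count (fun s => P s && ~~ nth false s i) (bitseqs n).

(* With [X] uniform in [P], [cond_entropy n P i] is [size_of n P] times the
   entropy of the bit [X_i] conditioned on [X_0, ..., X_(i-1)]. *)
Fixpoint cond_entropy n P i : R :=
  match n, i with
  | 0, _ => 0
  | m.+1, 0 => (size_of m.+1 P)%:R *
      entropy ((size_of m (residual false P))%:R / (size_of m.+1 P)%:R)
  | m.+1, j.+1 => cond_entropy m (residual false P) j +
      cond_entropy m (residual true P) j
  end.

Definition bitwise_or s t : bitseq := [seq x.1 || x.2 | x <- zip s t].

Lemma mem_bitseqs n s : (s \in bitseqs n) = (size s == n).
Proof.
elim: n s => [|n IH] [|b s] //=; rewrite mem_cat.
  by apply/negbTE/norP; split; apply/mapP => -[].
rewrite eqSS -IH; apply/orP/idP => [[]/mapP[t ts [_ ->]]//|s_n].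
by case: b; [right|left]; apply: map_f.
Qed.

Lemma uniq_bitseqs n : uniq (bitseqs n).
Proof.
elim: n => //= n IH; rewrite cat_uniq !map_inj_uniq ?IH ?andbT//=; last 2 first.
- by move=> ? ? [].
- by move=> ? ? [].
by apply/hasPn => _ /mapP[s _ ->]; apply/mapP => -[].
Qed.

Lemma size_ofS n P :
  size_of n.+1 P = (size_of n (residual false P) + size_of n (residual true P))%N.
Proof. by rewrite /size_of /= count_cat !count_map. Qed.

Lemma size_without0 n P : size_without n.+1 P 0 = size_of n (residual false P).
Proof.
rewrite /size_without /= count_cat !count_map [X in (_ + X)%N](@eq_count _ _ pred0).
  by rewrite count_pred0 addn0; apply: eq_count => s /=; rewrite andbT.
by move=> s /=; rewrite andbF.
Qed.

Lemma size_withoutS n P i : size_without n.+1 P i.+1 =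
  (size_without n (residual false P) i + size_without n (residual true P) i)%N.
Proof. by rewrite /size_without /= count_cat !count_map. Qed.

Lemma size_of_gt0P n P :
  reflect (exists2 s, size s = n & P s) (0 < size_of n P)%N.
Proof.
rewrite /size_of -has_count; apply: (iffP hasP) => -[s].
  by rewrite mem_bitseqs => /eqP; exists s.
by move=> /eqP sn Ps; exists s; rewrite ?mem_bitseqs.
Qed.

Lemma cond_entropy_ge0 n P i : 0 <= cond_entropy n P i.
Proof.
elim: n P i => [|n IH] P [|i] //=; last by rewrite addr_ge0.
rewrite mulr_ge0// entropy_ge0// divr_ge0//=.
have [->|N0] := eqVneq (size_of n.+1 P) 0%N; first by rewrite invr0 mulr0.
by rewrite ler_pdivrMr ?mul1r ?ler_nat ?size_ofS ?leq_addr// -size_ofS ltr0n lt0n.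
Qed.

(** The chain rule for a uniform member of [P], whose entropy is the logarithm of the size;
    [entropy_chain] splits off the first bit. *)
Lemma sum_cond_entropy n P :
  \sum_(i < n) cond_entropy n P i = (size_of n P)%:R * ln (size_of n P)%:R.
Proof.
elim: n P => [|n IH] P.
  by rewrite big_ord0 /size_of /= addn0; case: (P _); rewrite ?ln1 ?mulr0 ?mul0r.
rewrite big_ord_recl big_split /= !IH size_ofS natrD.
by rewrite [RHS]entropy_chain// addrA.
Qed.

Lemma size_bitwise_or n s t : size s = n -> size t = n -> size (bitwise_or s t) = n.
Proof. by move=> sn tn; rewrite size_map size_zip sn tn minnn. Qed.

(** Three families are needed because fixing different first bits turns one family into distinct
    residuals. *)
Definition or_closed n P Q C := forall s t, size s = n -> size t = n ->
  P s -> Q t -> C (bitwise_or s t).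

Lemma or_closed_section n P Q C b b' : or_closed n.+1 P Q C ->
  or_closed n (residual b P) (residual b' Q) (residual (b || b') C).
Proof.
by move=> clC s t sn tn Ps Qt; apply: (clC (b :: s) (b' :: t)) => //=; rewrite ?sn ?tn.
Qed.

(** Supplies the vanishing conditions of [gibbs] when a residual of [C] is empty. *)
Lemma size_of_or_closed n P Q C : or_closed n P Q C ->
  size_of n C = 0%N -> (size_of n P * size_of n Q = 0)%N.
Proof.
move=> clC C0; apply/eqP; rewrite -leqn0 leqNgt muln_gt0; apply/negP.
move=> /andP[/size_of_gt0P[s sn Ps] /size_of_gt0P[t tn Qt]].
suff : (0 < size_of n C)%N by rewrite C0.
by apply/size_of_gt0P; exists (bitwise_or s t); [exact: size_bitwise_or|exact: clC].
Qed.

End BitFamilies.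

(** * The entropy bound on the number of unions *)

Section UnionEntropy.
Variable R : realType.
Implicit Types (n i : nat) (P Q C : bitseq -> bool).
Notation phi := (golden R).
Notation H := (@cond_entropy R).

(** For independent uniform [A] in [P] and [B] in [Q], this is the product of the sizes times the
    sum over [i] of the probability that [A] misses [i] times the conditional entropy of [B_i], plus
    the same with [A] and [B] exchanged. *)
Definition cross_entropy n P Q : R := \sum_(i < n)
  ((size_without n P i)%:R * H n Q i + (size_without n Q i)%:R * H n P i).

Lemma cross_entropyS n P Q (P0 := residual false P) (P1 := residual true P)
    (Q0 := residual false Q) (Q1 := residual true Q) :
  cross_entropy n.+1 P Q =
    ((size_of n P0)%:R * H n.+1 Q 0 + (size_of n Q0)%:R * H n.+1 P 0) +
    (cross_entropy n P0 Q0 + cross_entropy n P0 Q1 +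
     cross_entropy n P1 Q0 + cross_entropy n P1 Q1).
Proof.
rewrite /cross_entropy big_ord_recl !size_without0; congr (_ + _).
rewrite -!big_split; apply: eq_bigr => i _ /=.
by rewrite !size_withoutS !natrD; ring.
Qed.

(** Induction on coordinates: [entropy_mul] bounds the first one. Of the four pairs of residuals
    only false with false lands in [residual false C], so [gibbs] with [p = x * y] merges the four
    inductive bounds. *)
Lemma cross_entropy_le n P Q C : or_closed n P Q C ->
  cross_entropy n P Q <=
    2 * phi * ((size_of n P)%:R * (size_of n Q)%:R * ln (size_of n C)%:R).
Proof.
elim: n P Q C => [|n IH] P Q C clC.
  (* Only the empty sequence remains, so the size of [C] is [0] or [1] and its logarithm is [0]
     either way. *)
  rewrite /cross_entropy big_ord0 (_ : ln _ = 0) ?mulr0//.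
  by rewrite /size_of /= addn0; case: (C _); rewrite ?ln1 ?ln0.
have cl b b' := or_closed_section (b := b) (b' := b') clC.
rewrite cross_entropyS /= -!/(residual _ _).
have := IH _ _ _ (cl false false); have := IH _ _ _ (cl false true).
have := IH _ _ _ (cl true false); have := IH _ _ _ (cl true true).
have := size_of_or_closed (cl false false).
have := size_of_or_closed (cl false true).
have := size_of_or_closed (cl true false).
have := size_of_or_closed (cl true true).
rewrite /= !size_ofS.
move: (size_of n (residual false P)) (size_of n (residual true P)) => a b.
move: (size_of n (residual false Q)) (size_of n (residual true Q)) => c d.
move: (size_of n (residual false C)) (size_of n (residual true C)) => m0 m1.
move=> m1bd m1bc m1ad m0ac le11 le10 le01 le00.
(* The proportions of [P] and [Q] with first bit false, equal to [0] for an empty family. *)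
set x : R := a%:R / (a + b)%:R; set y : R := c%:R / (c + d)%:R.
have frac01 (k l : nat) : 0 <= (k%:R / (k + l)%:R : R) <= 1.
  rewrite divr_ge0//=; have [->|kl0] := posnP (k + l).
    by rewrite invr0 mulr0.
  by rewrite ler_pdivrMr ?ltr0n// mul1r ler_nat leq_addr.
have fracK (k l : nat) : (k + l)%:R * (k%:R / (k + l)%:R) = k%:R :> R.
  have [/eqP|kl0] := posnP (k + l).
    by rewrite addn_eq0 => /andP[/eqP-> /eqP->]; rewrite !mul0r.
  by rewrite mulrC divfK// pnatr_eq0 -lt0n.
have ax : a%:R = (a + b)%:R * x by rewrite fracK.
have cy : c%:R = (c + d)%:R * y by rewrite fracK.
have first_le : a%:R * ((c + d)%:R * entropy y) + c%:R * ((a + b)%:R * entropy x)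
    <= 2 * phi * ((a + b)%:R * (c + d)%:R * entropy (x * y)).
  rewrite [in leLHS]ax [in leLHS]cy.
  rewrite (_ : _ + _ =
    (a + b)%:R * (c + d)%:R * (x * entropy y + y * entropy x)); last by ring.
  rewrite (_ : 2 * phi * _ =
    (a + b)%:R * (c + d)%:R * (2 * phi * entropy (x * y))); last by ring.
  by rewrite ler_wpM2l ?mulr_ge0// entropy_mul// frac01.
have gibbs_le : (a + b)%:R * (c + d)%:R * entropy (x * y) + a%:R * c%:R * ln m0%:R
    + (a%:R * d%:R + b%:R * c%:R + b%:R * d%:R) * ln m1%:R
    <= (a + b)%:R * (c + d)%:R * ln (m0 + m1)%:R.
  have [abcd0|abcd0] := eqVneq ((a + b) * (c + d))%N 0%N.
    have : [|| a + b == 0 | c + d == 0]%N by rewrite -muln_eq0 abcd0.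
    by case/orP; rewrite addn_eq0 => /andP[/eqP-> /eqP->];
      rewrite !(mul0r, mulr0, addr0).
  have -> : a%:R * c%:R = (a + b)%:R * (c + d)%:R * (x * y).
    by rewrite {1}ax {1}cy; ring.
  have -> : a%:R * d%:R + b%:R * c%:R + b%:R * d%:R =
      (a + b)%:R * (c + d)%:R * (1 - x * y).
    rewrite (_ : (a + b)%:R * (c + d)%:R * (1 - x * y) =
      (a + b)%:R * (c + d)%:R - (a + b)%:R * x * ((c + d)%:R * y)); last by ring.
    by rewrite -ax -cy !natrD; ring.
  rewrite [leLHS](_ : _ = (a + b)%:R * (c + d)%:R *
    (entropy (x * y) + x * y * ln m0%:R + (1 - x * y) * ln m1%:R)); last by ring.
  rewrite (natrD _ m0) ler_wpM2l ?mulr_ge0//.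
  have xy0 : (a * c = 0)%N -> x * y = 0.
    by move=> /eqP; rewrite muln_eq0 => /orP[]/eqP z0; rewrite /x /y z0 !mul0r ?mulr0.
  have /andP[x0 x1] := frac01 a b; have /andP[y0 y1] := frac01 c d.
  apply: gibbs => //; first by rewrite mulr_ge0// mulr_ile1.
    by move=> /eqP; rewrite pnatr_eq0 => /eqP /m0ac /xy0.
  move=> /eqP; rewrite pnatr_eq0 => /eqP m1_eq0.
  (* With [m1 = 0] the three other products vanish, which forces [x * y = 1]. *)
  have abcd_ac : ((a + b) * (c + d) = a * c)%N.
    rewrite mulnDl !mulnDr.
    by rewrite (m1ad m1_eq0) (m1bc m1_eq0) (m1bd m1_eq0) !addn0.
  have ab0 : (a + b)%:R != 0 :> R.
    by rewrite pnatr_eq0; move: abcd0; rewrite muln_eq0 negb_or => /andP[].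
  have cd0 : (c + d)%:R != 0 :> R.
    by rewrite pnatr_eq0; move: abcd0; rewrite muln_eq0 negb_or => /andP[].
  rewrite /x /y mulf_div -!natrM abcd_ac divff// -abcd_ac natrM mulf_neq0//.
have phi0 : 0 <= 2 * phi by rewrite mulr_ge0// ltW// golden_gt0.
apply: le_trans (ler_wpM2l phi0 gibbs_le).
lra.
Qed.

End UnionEntropy.

(** * Subsets as bit sequences, and the union-closed family *)

Section SetFamilies.
Variable n : nat.

Definition set_of_bits (s : bitseq) : {set 'I_n} := [set i : 'I_n | nth false s i].

(** [set_of_bits] is a bijection from the sequences of length [n] onto the subsets, with membership
    bits as inverse. *)
Lemma count_set_of_bits (Q : pred {set 'I_n}) :
  count (fun s => Q (set_of_bits s)) (bitseqs n) = #|[set A | Q A]|.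
Proof.
pose bits_of (A : {set 'I_n}) : bitseq := [seq i \in A | i <- enum 'I_n].
have nth_bits A (i : 'I_n) : nth false (bits_of A) i = (i \in A).
  by rewrite (nth_map i) ?size_enum_ord// nth_ord_enum.
have perm_sets : perm_eq (map set_of_bits (bitseqs n)) (enum {set 'I_n}).
  apply: uniq_perm => [||A]; last 2 first.
  - exact: enum_uniq.
  - rewrite mem_enum; apply/mapP; exists (bits_of A).
      by rewrite mem_bitseqs size_map size_enum_ord.
    by apply/setP => i; rewrite inE nth_bits.
  - rewrite map_inj_in_uniq ?uniq_bitseqs// => s t.
    rewrite !mem_bitseqs => /eqP sn /eqP tn /setP st.
    apply: (@eq_from_nth _ false); rewrite ?sn ?tn// => i i_n.
    by have := st (Ordinal i_n); rewrite !inE.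
rewrite cardsE cardE /enum_mem size_filter -enumT.
by rewrite -(seq.permP perm_sets) count_map.
Qed.

End SetFamilies.

Theorem theorem2 (R : realType) (n : nat) (F : {set {set 'I_n}})
  (n_ge1 : (1 <= n)%N)
  (F_union_closed : union_closed F)
  (F_nonempty_member : exists S : {set 'I_n}, S \in F /\ S != set0) :
  exists i : 'I_n,
    (3 - Num.sqrt 5) / 2 * (#|F|)%:R <= (#|[set S in F | i \in S]|)%:R :> R.
Proof.
rewrite (_ : (3 - Num.sqrt 5) / 2 = 1 - golden R); last first.
  by rewrite /golden; field.
case: (boolP [exists i : 'I_n, (1 - golden R) * #|F|%:R <=
    #|[set S in F | i \in S]|%:R :> R]) => [/existsP//|/existsPn rare].
have [S [SF S_neq0]] := F_nonempty_member.
pose P s := set_of_bits n s \in F.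
have sizeP : size_of n P = #|F|.
  rewrite /size_of (count_set_of_bits [pred A | A \in F]).
  by congr #|pred_of_set _|; apply/setP => A; rewrite inE.
have size_withoutP (i : 'I_n) :
    size_without n P i = #|[set A in F | i \notin A]|.
  rewrite -(count_set_of_bits [pred A : {set 'I_n} | (A \in F) && (i \notin A)]).
  by apply: eq_count => s; rewrite /= inE.
have P_closed : or_closed n P P P.
  move=> s t sn tn Ps Pt; rewrite /P.
  have -> : set_of_bits n (bitwise_or s t) = set_of_bits n s :|: set_of_bits n t.
    apply/setP => i; rewrite !inE (nth_map (false, false)).
      by rewrite nth_zip ?sn ?tn.
    by rewrite size_zip sn tn minnn.
  exact: F_union_closed.
have := cross_entropy_le R P_closed; rewrite sizeP.
set N : R := #|F|%:R; set H := cond_entropy R n P.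
have without_gt (i : 'I_n) : golden R * N < (size_without n P i)%:R.
  have cardF : N = #|[set A in F | i \in A]|%:R + (size_without n P i)%:R.
    rewrite size_withoutP -natrD /N; congr _%:R.
    rewrite -(cardsID [set A : {set 'I_n} | i \in A] F); congr (_ + _)%N.
      by apply: eq_card => A; rewrite !inE.
    by apply: eq_card => A; rewrite !inE andbC.
  have := rare i; rewrite -ltNge -/N => lt_rare.
  by rewrite cardF in lt_rare *; lra.
have sumH : \sum_(i < n) H i = N * ln N by rewrite sum_cond_entropy sizeP.
rewrite /cross_entropy -/H => le_cross.
(* With all three families equal to [P], the bound is [2 * golden R * N] times [N * ln N], and
   [N * ln N] is the sum of the [H i]. *)
have sum_le0 : \sum_(i < n) ((size_without n P i)%:R - golden R * N) * H i <= 0.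
  rewrite -subr_le0 in le_cross; rewrite -(@pmulr_rle0 _ 2)//.
  apply: etrans le_cross; congr (_ <= _).
  rewrite -(mulrA N) -sumH !mulr_sumr -sumrB.
  by apply: eq_bigr => i _; ring.
have term_ge0 (i : 'I_n) : 0 <= ((size_without n P i)%:R - golden R * N) * H i.
  by rewrite mulr_ge0 ?cond_entropy_ge0// subr_ge0 ltW.
have sum0 : \sum_(i < n) ((size_without n P i)%:R - golden R * N) * H i = 0.
  by apply/eqP; rewrite eq_le sum_le0 sumr_ge0.
(* Each coefficient of [H i] is strictly positive, so every [H i] vanishes; then [ln N = 0] and [F]
   consists of [S] alone, whose elements are missing from no member. *)
have H0 (i : 'I_n) : H i = 0.
  have /eqP := psumr_eq0P (fun j _ => term_ge0 j) sum0 (i := i) isT.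
  by rewrite mulf_eq0 gt_eqF ?subr_gt0//= => /eqP.
have F_gt0 : (0 < #|F|)%N by rewrite card_gt0; apply/set0Pn; exists S.
have F1 : #|F| = 1%N.
  have : N * ln N = 0 by rewrite -sumH big1.
  move=> /eqP; rewrite mulf_eq0 pnatr_eq0 -leqn0 leqNgt F_gt0 /=.
  by rewrite ln_eq0 ?ltr0n// pnatr_eq1 => /eqP.
have /set0Pn[i iS] := S_neq0.
have := without_gt i; rewrite size_withoutP.
have -> : [set A in F | i \notin A] = set0.
  have /eqP/cards1P[B FB] := F1.
  apply/setP => A; rewrite !inE FB inE; apply/negbTE/negP => /andP[/eqP-> ].
  by move: SF; rewrite FB inE => /eqP <-; rewrite iS.
by rewrite cards0 pmulr_llt0 ?ltr0n// ltNge ltW ?golden_gt0.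
Qed.
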